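(* Let $(g_L,Z,\lambda,\rho)$ be a Lyra almost Ricci--Bourguignon soliton on a Lyra twisted warped product $M=M_1\times_fM_2$ with scale $\varphi$, $n=\dim M=n_1+n_2$, $k=\ln f$, $\sigma=\ln\varphi$. Then $$(1-n\rho)R^L+\operatorname{div}_LZ=n\lambda .$$ If $Z=Z_1+Z_2$ where $Z_1,Z_2$ are the canonical lifts of vector fields on $M_1$ and $M_2$ respectively, then $$\operatorname{div}_LZ=\operatorname{div}_1Z_1+\operatorname{div}_2Z_2+n_2Z(k)+nZ(\sigma),$$ and hence $$(1-n\rho)R^L+\operatorname{div}_1Z_1+\operatorname{div}_2Z_2+n_2Z(k)+nZ(\sigma)=n\lambda .$$
   Context: Lyra twisted warped product: $(M_1,g_1),(M_2,g_2)$ are smooth pseudo-Riemannian manifolds of positive dimensions $n_1,n_2$; $f,\varphi:M_1\times M_2\to(0,\infty)$ are smooth; $M=M_1\times M_2$ carries $g=g_1\oplus f^2g_2$ and the Lyra metric $g_L=\varphi^2g=e^{2\sigma}g$. $\operatorname{Ric}^L,R^L$ are the Ricci tensor and scalar curvature of (the Levi-Civita connection of) $g_L$. A Lyra almost Ricci--Bourguignon soliton is $(g_L,Z,\lambda,\rho)$ with $Z$ a smooth vector field on $M$, $\lambda\in C^\infty(M)$, $\rho\in\mathbb R$, satisfying $\operatorname{Ric}^L+\frac12\mathcal L_Zg_L=(\lambda+\rho R^L)g_L$. $\operatorname{div}_L$, $\operatorname{div}_1$, $\operatorname{div}_2$ are the divergences with respect to $g_L$, $g_1$, $g_2$. *)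

(* Defs.v *)
From HB Require Import structures.
From mathcomp Require Import all_boot all_order all_algebra.
From mathcomp Require Import all_classical all_reals all_analysis.
From mathcomp Require Import ring.
Set Implicit Arguments.
Unset Strict Implicit.
Unset Printing Implicit Defensive.
Import Order.TTheory GRing.Theory Num.Theory.
Import numFieldNormedType.Exports.
Local Open Scope classical_set_scope.
Local Open Scope ring_scope.

Section SmoothFunctions.
Context {R : realType} {n : nat}.
Implicit Types (U : set 'rV[R]_n) (h : 'rV[R]_n -> R).

Definition pderiv (k : 'I_n) h (x : 'rV[R]_n) : R := 'D_(delta_mx 0 k) h x.

(* C^m on the open set U; the values of h outside U play no role. *)
Fixpoint Ck_on (m : nat) U h : Prop :=
  (forall x, U x -> {for x, continuous h}) /\
  if m is m'.+1 then
    forall k, (forall x, U x -> derivable h x (delta_mx 0 k)) /\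
              Ck_on m' U (pderiv k h)
  else True.

Definition smooth_on U h := forall m, Ck_on m U h.

Lemma Ck_on_sub m U V h : V `<=` U -> Ck_on m U h -> Ck_on m V h.
Proof.
elim: m h => [|m IHm] h VU [hc hd]; first by split=> // x /VU; exact: hc.
split=> [x /VU|k]; first exact: hc.
by split=> [x /VU|]; [exact: (hd k).1|apply: IHm; [|exact: (hd k).2]].
Qed.

Lemma Ck_on_eq m U h h' : open U -> (forall x, U x -> h x = h' x) ->
  Ck_on m U h -> Ck_on m U h'.
Proof.
move=> oU; elim: m h h' => [|m IHm] h h' hh' [hc hd].
all: have near_hh' x : U x -> \forall y \near x, h y = h' y.
1,3: by move=> Ux; apply: filterS (open_nbhs_nbhs (conj oU Ux)).
all: have hc' x : U x -> {for x, continuous h'}.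
1,3: move=> Ux; rewrite /prop_for /continuous_at -hh' //.
1,2: by apply: cvg_trans (hc x Ux); exact: near_eq_cvg (near_hh' x Ux).
- by split.
- split=> // k; split=> [x Ux|].
    exact: near_eq_derivable (near_hh' x Ux) ((hd k).1 x Ux).
  apply: IHm (hd k).2 => x Ux.
  exact: near_eq_derive (near_hh' x Ux).
Qed.

Lemma Ck_on_cst m U (a : R) : Ck_on m U (fun=> a).
Proof.
elim: m a => [|m IHm] a; first by split=> // x _; exact: cst_continuous.
split=> [x _|k]; first exact: cst_continuous.
split=> [x _|]; first exact: derivable_cst.
rewrite (_ : pderiv k _ = fun=> 0) //.
by apply/funext => x; exact: derive_cst.
Qed.

Lemma Ck_onW m U h : Ck_on m.+1 U h -> Ck_on m U h.
Proof.
elim: m h => [|m IHm] h [hc hd]; first by [].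
by split=> // k; split; [exact: (hd k).1|apply: IHm; exact: (hd k).2].
Qed.

Lemma Ck_onD m U h h' : open U ->
  Ck_on m U h -> Ck_on m U h' -> Ck_on m U (fun x => h x + h' x).
Proof.
move=> oU; elim: m h h' => [|m IHm] h h' [hc hd] [hc' hd'].
  by split=> // x Ux; apply: continuousD; [exact: hc|exact: hc'].
split=> [x Ux|k]; first by apply: continuousD; [exact: hc|exact: hc'].
split=> [x Ux|]; first exact: derivableD ((hd k).1 x Ux) ((hd' k).1 x Ux).
apply: Ck_on_eq (IHm _ _ (hd k).2 (hd' k).2) => // x Ux.
by apply/esym; exact: deriveD ((hd k).1 x Ux) ((hd' k).1 x Ux).
Qed.

Lemma Ck_onM m U h h' : open U ->
  Ck_on m U h -> Ck_on m U h' -> Ck_on m U (fun x => h x * h' x).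
Proof.
move=> oU; elim: m h h' => [|m IHm] h h' hC hC'.
  by split=> // x Ux; apply: continuousM; [exact: hC.1|exact: hC'.1].
have [[hc hd] [hc' hd']] := (hC, hC').
split=> [x Ux|k]; first by apply: continuousM; [exact: hc|exact: hc'].
split=> [x Ux|]; first exact: derivableM ((hd k).1 x Ux) ((hd' k).1 x Ux).
pose D x := h x * pderiv k h' x + h' x * pderiv k h x.
apply: (@Ck_on_eq _ _ D) => // [x Ux|].
  by apply/esym; exact: deriveM ((hd k).1 x Ux) ((hd' k).1 x Ux).
apply: Ck_onD => //.
  by apply: IHm; [exact: Ck_onW|exact: (hd' k).2].
by apply: IHm; [exact: Ck_onW|exact: (hd k).2].
Qed.

End SmoothFunctions.

Section SmoothBlocks.
Context {R : realType} {n1 n2 : nat}.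

Lemma lsubmx_delta (k : 'I_(n1 + n2)) :
  lsubmx (delta_mx 0 k : 'rV[R]_(n1 + n2)) =
  if fintype.split k is inl a then delta_mx 0 a else 0.
Proof.
apply/rowP => j; rewrite mxE mxE.
case: splitP => a ka; rewrite mxE eqxx /=; first by rewrite -val_eqE /= ka.
by rewrite -val_eqE /= ka ltn_eqF // ltn_addr.
Qed.

Lemma rsubmx_delta (k : 'I_(n1 + n2)) :
  rsubmx (delta_mx 0 k : 'rV[R]_(n1 + n2)) =
  if fintype.split k is inr a then delta_mx 0 a else 0.
Proof.
apply/rowP => j; rewrite mxE mxE.
case: splitP => a ka; rewrite mxE eqxx /=; last first.
  by rewrite -val_eqE /= ka eqn_add2l.
by rewrite -val_eqE /= ka gtn_eqF // ltn_addr.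
Qed.

Let quotient_lsubmx (h1 : 'rV[R]_n1 -> R) (x v : 'rV[R]_(n1 + n2)) :
  (fun t : R => t^-1 *: (((h1 \o lsubmx) \o shift x) (t *: v) - (h1 \o lsubmx) x)) =
  (fun t : R => t^-1 *: ((h1 \o shift (lsubmx x)) (t *: lsubmx v) - h1 (lsubmx x))).
Proof.
apply/funext => t /=.
suff -> : lsubmx (t *: v + x) = t *: lsubmx v + lsubmx x by [].
by apply/rowP => j; rewrite !mxE.
Qed.

Lemma derive_lsubmx (h1 : 'rV[R]_n1 -> R) (x v : 'rV[R]_(n1 + n2)) :
  'D_v (h1 \o lsubmx) x = 'D_(lsubmx v) h1 (lsubmx x).
Proof. by rewrite /derive quotient_lsubmx. Qed.

Lemma derivable_lsubmx (h1 : 'rV[R]_n1 -> R) (x v : 'rV[R]_(n1 + n2)) :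
  derivable h1 (lsubmx x) (lsubmx v) -> derivable (h1 \o lsubmx) x v.
Proof. by rewrite /derivable quotient_lsubmx. Qed.

Let quotient_rsubmx (h2 : 'rV[R]_n2 -> R) (x v : 'rV[R]_(n1 + n2)) :
  (fun t : R => t^-1 *: (((h2 \o rsubmx) \o shift x) (t *: v) - (h2 \o rsubmx) x)) =
  (fun t : R => t^-1 *: ((h2 \o shift (rsubmx x)) (t *: rsubmx v) - h2 (rsubmx x))).
Proof.
apply/funext => t /=.
suff -> : rsubmx (t *: v + x) = t *: rsubmx v + rsubmx x by [].
by apply/rowP => j; rewrite !mxE.
Qed.

Lemma derive_rsubmx (h2 : 'rV[R]_n2 -> R) (x v : 'rV[R]_(n1 + n2)) :
  'D_v (h2 \o rsubmx) x = 'D_(rsubmx v) h2 (rsubmx x).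
Proof. by rewrite /derive quotient_rsubmx. Qed.

Lemma derivable_rsubmx (h2 : 'rV[R]_n2 -> R) (x v : 'rV[R]_(n1 + n2)) :
  derivable h2 (rsubmx x) (rsubmx v) -> derivable (h2 \o rsubmx) x v.
Proof. by rewrite /derivable quotient_rsubmx. Qed.

Lemma smooth_on_lsubmx (U : set 'rV[R]_n1) (h1 : 'rV[R]_n1 -> R) :
  smooth_on U h1 -> smooth_on (lsubmx @^-1` U) (h1 \o @lsubmx R 1 n1 n2).
Proof.
move=> + m; move=> /(_ m).
have comp_cont (h : 'rV[R]_n1 -> R) (x : 'rV[R]_(n1 + n2)) :
    {for lsubmx x, continuous h} ->
    {for x, continuous (h \o @lsubmx R 1 n1 n2)}.
  by move=> hx; exact: (continuous_comp (@continuous_lsubmx _ _ _ _ x) hx).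
elim: m h1 => [|m IHm] h1 [hc hd].
  by split=> // x Ux; apply: comp_cont; exact: hc.
split=> [x Ux|k]; first by apply: comp_cont; exact: hc.
have := lsubmx_delta k; case: fintype.split => a ka.
  split=> [x Ux|]; first by apply: derivable_lsubmx; rewrite ka; exact: (hd a).1.
  rewrite (_ : pderiv k _ = pderiv a h1 \o lsubmx); first exact: IHm (hd a).2.
  by apply/funext => x; rewrite /pderiv derive_lsubmx ka.
split=> [x Ux|]; first by apply: derivable_lsubmx; rewrite ka; exact: derivable0.
rewrite (_ : pderiv k _ = fun=> 0); first exact: Ck_on_cst.
by apply/funext => x; rewrite /pderiv derive_lsubmx ka derive0.
Qed.

Lemma smooth_on_rsubmx (U : set 'rV[R]_n2) (h2 : 'rV[R]_n2 -> R) :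
  smooth_on U h2 -> smooth_on (rsubmx @^-1` U) (h2 \o @rsubmx R 1 n1 n2).
Proof.
move=> + m; move=> /(_ m).
have comp_cont (h : 'rV[R]_n2 -> R) (x : 'rV[R]_(n1 + n2)) :
    {for rsubmx x, continuous h} ->
    {for x, continuous (h \o @rsubmx R 1 n1 n2)}.
  by move=> hx; exact: (continuous_comp (@continuous_rsubmx _ _ _ _ x) hx).
elim: m h2 => [|m IHm] h2 [hc hd].
  by split=> // x Ux; apply: comp_cont; exact: hc.
split=> [x Ux|k]; first by apply: comp_cont; exact: hc.
have := rsubmx_delta k; case: fintype.split => a ka.
  split=> [x Ux|]; first by apply: derivable_rsubmx; rewrite ka; exact: derivable0.
  rewrite (_ : pderiv k _ = fun=> 0); first exact: Ck_on_cst.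
  by apply/funext => x; rewrite /pderiv derive_rsubmx ka derive0.
split=> [x Ux|]; first by apply: derivable_rsubmx; rewrite ka; exact: (hd a).1.
rewrite (_ : pderiv k _ = pderiv a h2 \o rsubmx); first exact: IHm (hd a).2.
by apply/funext => x; rewrite /pderiv derive_rsubmx ka.
Qed.

End SmoothBlocks.

Record chart (R : realType) (M : topologicalType) (n : nat) := Chart {
  dom : set M;
  coord :> M -> 'rV[R]_n;
  param : 'rV[R]_n -> M;
  dom_open : open dom;
  cod_open : open (coord @` dom);
  coordK : forall p, dom p -> param (coord p) = p;
  coord_cont : forall p, dom p -> {for p, continuous coord};
  param_cont : forall x, (coord @` dom) x -> {for x, continuous param}
}.

Definition smooth_transition (R : realType) (M : topologicalType) (n : nat)
    (c c' : chart R M n) : Prop :=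
  forall b : 'I_n,
    smooth_on (c @` (dom c `&` dom c')) (fun x => c' (param c x) 0 b).

(* Pitfall: a distinguished chart around each point is part of the data.  It
   only serves to evaluate scalars (traces, contractions) at that point, whose
   values do not depend on the chart used. *)
Record manifold (R : realType) (n : nat) := Manifold {
  space :> topologicalType;
  space_hausdorff : hausdorff_space space;
  space_countable : @second_countable space;
  index : Type;
  atlas : index -> chart R space n;
  chart_at : space -> index;
  chart_atP : forall p, dom (atlas (chart_at p)) p;
  atlas_compat : forall i j, smooth_transition (atlas i) (atlas j)
}.
Arguments index {R n} m.
Arguments atlas {R n} m i.
Arguments chart_at {R n} m p.

Section ProductChart.
Context {R : realType} {n1 n2 : nat}.

Lemma hausdorff_prod (T U : topologicalType) :
  hausdorff_space T -> hausdorff_space U -> hausdorff_space (T * U)%type.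
Proof.
move=> hT hU [p1 p2] [q1 q2] cl; congr pair.
- apply: hT => A B pA qB.
  have [||[x1 x2] [/= xA xB]] := cl (A `*` setT) (B `*` setT).
  + by exists (A, setT) => //; split => //; exact: filterT.
  + by exists (B, setT) => //; split => //; exact: filterT.
  + by exists x1; split; [exact: xA.1|exact: xB.1].
- apply: hU => A B pA qB.
  have [||[x1 x2] [/= xA xB]] := cl (setT `*` A) (setT `*` B).
  + by exists (setT, A) => //; split => //; exact: filterT.
  + by exists (setT, B) => //; split => //; exact: filterT.
  + by exists x2; split; [exact: xA.2|exact: xB.2].
Qed.

Lemma open_prod (T U : topologicalType) (A : set T) (B : set U) :
  open A -> open B -> open (A `*` B).
Proof.
rewrite !openE => oA oB [x y] [/= Ax By].
by exists (A, B) => //; split; [exact: oA|exact: oB].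
Qed.

Lemma second_countable_prod (T U : topologicalType) :
  @second_countable T -> @second_countable U ->
  @second_countable (T * U)%type.
Proof.
move=> [B cB [oB bB]] [C cC [oC bC]].
exists ((fun AD : set T * set U => AD.1 `*` AD.2) @` (B `*` C)).
  apply: card_le_trans (card_image_le _ _) _.
  exact: countableX.
split; first by move=> _ [[A D] [/= BA CD] <-]; apply: open_prod; [exact: oB|exact: oC].
move=> [x y] W [[P Q] [/= Px Qy]] PQW.
have [A [BA Ax] AP] := bB x P Px.
have [D [CD Dy] DQ] := bC y Q Qy.
exists (A `*` D); last by move=> [a d] [/= Aa Dd]; apply: PQW; split; [exact: AP|exact: DQ].
by split; [exists (A, D)|].
Qed.

Context {M1 M2 : topologicalType} (c1 : chart R M1 n1) (c2 : chart R M2 n2).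

Definition prod_dom : set (M1 * M2) := dom c1 `*` dom c2.
Definition prod_coord (p : M1 * M2) : 'rV[R]_(n1 + n2) :=
  row_mx (c1 p.1) (c2 p.2).
Definition prod_param (x : 'rV[R]_(n1 + n2)) : M1 * M2 :=
  (param c1 (lsubmx x), param c2 (rsubmx x)).

Lemma continuous_row_mx (T : topologicalType) (u : T -> 'rV[R]_n1)
    (v : T -> 'rV[R]_n2) (x : T) :
  {for x, continuous u} -> {for x, continuous v} ->
  {for x, continuous (fun y => row_mx (u y) (v y))}.
Proof.
move=> cu cv A /nbhs_ballP[e /= e0 eA].
have := cu _ (nbhsx_ballx (u x) e e0).
have := cv _ (nbhsx_ballx (v x) e e0).
move=> nv nu; change (\forall y \near x, A (row_mx (u y) (v y))); near=> y.
have uxy : ball (u x) e (u y) by near: y; exact: nu.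
have vxy : ball (v x) e (v y) by near: y; exact: nv.
case: uxy vxy => [_ uxy] [_ vxy].
by apply: eA; split => // i j; rewrite !mxE; case: fintype.split => k.
Unshelve. all: by end_near. Qed.

Lemma prod_coord_image : prod_coord @` prod_dom =
  (lsubmx @^-1` (c1 @` dom c1)) `&` (rsubmx @^-1` (c2 @` dom c2)).
Proof.
apply/seteqP; split.
  move=> _ [[p q] [/= dp dq] <-]; split; rewrite /prod_coord /=.
    by rewrite row_mxKl; exists p.
  by rewrite row_mxKr; exists q.
move=> x [[p dp px] [q dq qx]]; exists (p, q) => //.
by rewrite /prod_coord /= px qx hsubmxK.
Qed.

Lemma prod_dom_open : open prod_dom.
Proof. by apply: open_prod; exact: dom_open. Qed.

Lemma prod_cod_open : open (prod_coord @` prod_dom).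
Proof.
rewrite prod_coord_image; apply: openI; apply: open_comp.
- by move=> x _; exact: continuous_lsubmx.
- exact: cod_open.
- by move=> x _; exact: continuous_rsubmx.
- exact: cod_open.
Qed.

Lemma prod_coordK p : prod_dom p -> prod_param (prod_coord p) = p.
Proof.
case: p => p q [/= dp dq]; rewrite /prod_param /prod_coord /=.
by rewrite row_mxKl row_mxKr !coordK.
Qed.

Lemma prod_coord_cont p : prod_dom p -> {for p, continuous prod_coord}.
Proof.
case: p => p q [/= dp dq]; apply: continuous_row_mx.
  by apply: continuous_comp; [exact: cvg_fst|exact: coord_cont].
by apply: continuous_comp; [exact: cvg_snd|exact: coord_cont].
Qed.

Lemma prod_param_cont x :
  (prod_coord @` prod_dom) x -> {for x, continuous prod_param}.
Proof.
rewrite prod_coord_image => -[x1 x2].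
have f1 : {for x, continuous (param c1 \o lsubmx)}.
  by apply: continuous_comp; [exact: continuous_lsubmx|exact: param_cont].
have f2 : {for x, continuous (param c2 \o rsubmx)}.
  by apply: continuous_comp; [exact: continuous_rsubmx|exact: param_cont].
exact: cvg_pair f1 f2.
Qed.

Definition prod_chart : chart R (M1 * M2)%type (n1 + n2) :=
  Chart prod_dom_open prod_cod_open prod_coordK prod_coord_cont
    prod_param_cont.

End ProductChart.

Section ProductManifold.
Context {R : realType} {n1 n2 : nat}.
Variables (M1 : manifold R n1) (M2 : manifold R n2).

Lemma prod_transition (T1 T2 : topologicalType) (c1 c1' : chart R T1 n1)
    (c2 c2' : chart R T2 n2) :
  smooth_transition c1 c1' -> smooth_transition c2 c2' ->
  smooth_transition (prod_chart c1 c2) (prod_chart c1' c2').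
Proof.
move=> s1 s2 b m; rewrite -(splitK b); case: fintype.split => a /=.
- have : Ck_on m (lsubmx @^-1` (c1 @` (dom c1 `&` dom c1')))
      ((fun x => c1' (param c1 x) 0 a) \o @lsubmx R 1 n1 n2).
    exact: smooth_on_lsubmx (s1 a) m.
  rewrite (_ : _ \o _ = fun x => prod_coord c1' c2' (prod_param c1 c2 x)
    0 (lshift n2 a)); last by apply/funext => x; rewrite row_mxEl.
  apply: Ck_on_sub => _ [[p q] [[/= dp dq] [/= dp' dq']] <-].
  by rewrite /= row_mxKl; exists p.
- have : Ck_on m (rsubmx @^-1` (c2 @` (dom c2 `&` dom c2')))
      ((fun x => c2' (param c2 x) 0 a) \o @rsubmx R 1 n1 n2).
    exact: smooth_on_rsubmx (s2 a) m.
  rewrite (_ : _ \o _ = fun x => prod_coord c1' c2' (prod_param c1 c2 x)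
    0 (rshift n1 a)); last by apply/funext => x; rewrite row_mxEr.
  apply: Ck_on_sub => _ [[p q] [[/= dp dq] [/= dp' dq']] <-].
  by rewrite /= row_mxKr; exists q.
Qed.

Definition prod_atlas (i : index M1 * index M2) :
    chart R (M1 * M2)%type (n1 + n2) :=
  prod_chart (atlas M1 i.1) (atlas M2 i.2).

Definition prod_chart_at (p : M1 * M2) : index M1 * index M2 :=
  (chart_at M1 p.1, chart_at M2 p.2).

Lemma prod_chart_atP p : dom (prod_atlas (prod_chart_at p)) p.
Proof. by split; exact: chart_atP. Qed.

Lemma prod_atlas_compat i j : smooth_transition (prod_atlas i) (prod_atlas j).
Proof. by apply: prod_transition; exact: atlas_compat. Qed.

Definition prod_manifold : manifold R (n1 + n2) :=
  Manifold (hausdorff_prod (@space_hausdorff _ _ M1) (@space_hausdorff _ _ M2))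
    (second_countable_prod (@space_countable _ _ M1) (@space_countable _ _ M2))
    prod_chart_atP prod_atlas_compat.

End ProductManifold.

Section Tensors.
Context {R : realType} {n : nat} {M : manifold R n}.
Local Notation cod i := (atlas M i @` dom (atlas M i)).

Definition smooth_fun (h : M -> R) : Prop :=
  forall i, smooth_on (cod i) (h \o param (atlas M i)).

(* The derivative of h at p along the k-th coordinate of the chart i. *)
Definition partial (i : index M) (k : 'I_n) (h : M -> R) (p : M) : R :=
  pderiv k (h \o param (atlas M i)) (atlas M i p).

Definition jacobian (i j : index M) (p : M) : 'M[R]_n :=
  \matrix_(a, b) partial i a (fun q => atlas M j q 0 b) p.

(* Tensor fields are given classically, by their components in every chart of
   the atlas; the components in the chart i matter only on dom (atlas M i), and
   those in different charts are related by the transformation laws below. *)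
Definition vector_comp := index M -> M -> 'rV[R]_n.
Definition tensor2_comp := index M -> M -> 'M[R]_n.

Definition smooth_vector_field (Z : vector_comp) : Prop :=
  (forall i k, smooth_on (cod i) (fun x => Z i (param (atlas M i) x) 0 k)) /\
  (forall i j p, dom (atlas M i) p -> dom (atlas M j) p ->
     Z j p = Z i p *m jacobian i j p).

Definition pseudo_riemannian (g : tensor2_comp) : Prop :=
  [/\ forall i a b, smooth_on (cod i) (fun x => g i (param (atlas M i) x) a b),
      forall i j p, dom (atlas M i) p -> dom (atlas M j) p ->
        g i p = jacobian i j p *m g j p *m (jacobian i j p)^T,
      forall i p, dom (atlas M i) p -> (g i p)^T = g i p &
      forall i p, dom (atlas M i) p -> g i p \in unitmx].

(* Coefficients of an affine connection, nabla_(d_a) d_b = G i c a b d_c. *)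
Definition connection := index M -> 'I_n -> 'I_n -> 'I_n -> M -> R.

Definition levi_civita (g : tensor2_comp) : connection := fun i c a b p =>
  2^-1 * \sum_d invmx (g i p) c d *
    (partial i a (fun q => g i q d b) p + partial i b (fun q => g i q d a) p
     - partial i d (fun q => g i q a b) p).

(* The d_l-component of R(d_a, d_b) d_k, where
   R(X, Y) = [nabla_X, nabla_Y] - nabla_[X, Y]. *)
Definition riemann (G : connection) (i : index M) (l k a b : 'I_n) (p : M) : R :=
  partial i a (G i l b k) p - partial i b (G i l a k) p
  + \sum_m (G i l a m p * G i m b k p - G i l b m p * G i m a k p).

(* Ric(Y, W) is the trace of X |-> R(X, Y) W. *)
Definition ricci (g : tensor2_comp) : tensor2_comp := fun i p =>
  \matrix_(b, k) \sum_a riemann (levi_civita g) i a k a b p.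

Definition scalar_curvature (g : tensor2_comp) (p : M) : R :=
  let i := chart_at M p in
  \sum_a \sum_b invmx (g i p) a b * ricci g i p a b.

(* The (a, b) entry is the d_b-component of nabla_(d_a) Z. *)
Definition covariant_derivative (G : connection) (Z : vector_comp) :
    tensor2_comp := fun i p =>
  \matrix_(a, b) (partial i a (fun q => Z i q 0 b) p
                  + \sum_c G i b a c p * Z i p 0 c).

Definition divergence (g : tensor2_comp) (Z : vector_comp) (p : M) : R :=
  \tr (covariant_derivative (levi_civita g) Z (chart_at M p) p).

Definition lie_derivative (Z : vector_comp) (g : tensor2_comp) :
    tensor2_comp := fun i p =>
  \matrix_(a, b) \sum_c (Z i p 0 c * partial i c (fun q => g i q a b) p
                         + g i p c b * partial i a (fun q => Z i q 0 c) p
                         + g i p a c * partial i b (fun q => Z i q 0 c) p).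

Definition vector_apply (Z : vector_comp) (h : M -> R) (p : M) : R :=
  let i := chart_at M p in \sum_a Z i p 0 a * partial i a h p.

Definition almost_ricci_bourguignon_soliton (g : tensor2_comp)
    (Z : vector_comp) (lam : M -> R) (rho : R) : Prop :=
  [/\ smooth_vector_field Z, smooth_fun lam &
      forall i p, dom (atlas M i) p ->
        ricci g i p + 2^-1 *: lie_derivative Z g i p =
        (lam p + rho * scalar_curvature g p) *: g i p].

Lemma partial_near i k (h h' : M -> R) p : dom (atlas M i) p ->
  (forall q, dom (atlas M i) q -> h q = h' q) ->
  partial i k h p = partial i k h' p.
Proof.
move=> dp hh'; apply: near_eq_derive.
have cp : cod i (atlas M i p) by exists p.
apply: filterS (open_nbhs_nbhs (conj (@cod_open _ _ _ (atlas M i)) cp)).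
by move=> _ [q dq <-] /=; rewrite coordK // hh'.
Qed.

Lemma levi_civita_torsion_free g i c a b p : pseudo_riemannian g ->
  dom (atlas M i) p -> levi_civita g i c a b p = levi_civita g i c b a p.
Proof.
move=> [_ _ gT _] dp; congr (_ * _); apply: eq_bigr => d _; congr (_ * (_ - _)).
  by rewrite addrC.
by apply: partial_near => // q dq; rewrite -{1}gT // mxE.
Qed.

Lemma levi_civita_metric g i a b c p : pseudo_riemannian g ->
  dom (atlas M i) p ->
  partial i c (fun q => g i q a b) p =
  \sum_d (levi_civita g i d c a p * g i p d b
          + levi_civita g i d c b p * g i p a d).
Proof.
move=> [_ _ gT gU] dp.
have sym x y z : partial i x (fun q => g i q y z) p
    = partial i x (fun q => g i q z y) p.
  by apply: partial_near => // q dq; rewrite -{1}gT // mxE.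
have invK y e : \sum_d invmx (g i p) d e * g i p d y = (y == e)%:R.
  have /matrixP/(_ y e) := mulmxV (gU i p dp).
  rewrite !mxE => <-; apply: eq_bigr => d _.
  by rewrite mulrC -{1}gT // mxE.
have lower x y : \sum_d levi_civita g i d c x p * g i p d y
  = 2^-1 * (partial i c (fun q => g i q y x) p
    + partial i x (fun q => g i q y c) p - partial i y (fun q => g i q c x) p).
  pose X e := partial i c (fun q => g i q e x) p
    + partial i x (fun q => g i q e c) p - partial i e (fun q => g i q c x) p.
  transitivity (\sum_e 2^-1 * X e * (y == e)%:R).
    under [RHS]eq_bigr do rewrite -invK mulr_sumr.
    rewrite exchange_big; apply: eq_bigr => d _ /=.
    rewrite /levi_civita -mulrA mulr_suml mulr_sumr.
    by apply: eq_bigr => e _; rewrite /X; ring.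
  rewrite (bigD1 y) //= eqxx mulr1 big1 ?addr0 // => e ey.
  by rewrite eq_sym (negPf ey) mulr0.
rewrite big_split /= lower.
under [X in _ + X]eq_bigr do rewrite -{1}gT // mxE.
rewrite lower (sym c b a) (sym b c a) (sym a b c) -mulrDr.
by field.
Qed.

End Tensors.
Arguments vector_comp {R n} M.
Arguments tensor2_comp {R n} M.

Section LyraTwistedProduct.
Context {R : realType} {n1 n2 : nat} {M1 : manifold R n1} {M2 : manifold R n2}.
Local Notation M := (prod_manifold M1 M2).

(* g1 (+) f^2 g2 *)
Definition twisted_metric (g1 : tensor2_comp M1) (g2 : tensor2_comp M2)
    (f : M -> R) : tensor2_comp M := fun i p =>
  block_mx (g1 i.1 p.1) 0 0 (f p ^+ 2 *: g2 i.2 p.2).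

Definition lyra_metric (g1 : tensor2_comp M1) (g2 : tensor2_comp M2)
    (f phi : M -> R) : tensor2_comp M := fun i p =>
  phi p ^+ 2 *: twisted_metric g1 g2 f i p.

Definition lift1 (Z1 : vector_comp M1) : vector_comp M := fun i p =>
  row_mx (Z1 i.1 p.1) 0.
Definition lift2 (Z2 : vector_comp M2) : vector_comp M := fun i p =>
  row_mx 0 (Z2 i.2 p.2).

Lemma partial_fst (i : index M) k (h : M1 -> R) (p : M) :
  partial i k (fun q : M => h q.1) p =
  if fintype.split k is inl a then partial i.1 a h p.1 else 0.
Proof.
rewrite /partial /pderiv -[_ \o _]/((h \o param (atlas M1 i.1)) \o lsubmx).
rewrite derive_lsubmx lsubmx_delta row_mxKl.
by case: fintype.split => // a; exact: derive0.
Qed.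

Lemma partial_snd (i : index M) k (h : M2 -> R) (p : M) :
  partial i k (fun q : M => h q.2) p =
  if fintype.split k is inr a then partial i.2 a h p.2 else 0.
Proof.
rewrite /partial /pderiv -[_ \o _]/((h \o param (atlas M2 i.2)) \o rsubmx).
rewrite derive_rsubmx rsubmx_delta row_mxKr.
by case: fintype.split => // a; exact: derive0.
Qed.

Lemma jacobian_prod (i j : index M) (p : M) :
  jacobian i j p =
  block_mx (jacobian i.1 j.1 p.1) 0 0 (jacobian i.2 j.2 p.2).
Proof.
have splitl m1 m2 (u : 'I_m1) : fintype.split (lshift m2 u) = inl u.
  exact: (unsplitK (inl u)).
have splitr m1 m2 (u : 'I_m2) : fintype.split (rshift m1 u) = inr u.
  exact: (unsplitK (inr u)).
apply/matrixP => a b; rewrite mxE -(splitK a) -(splitK b).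
case: (fintype.split b) => b' /=.
  rewrite (_ : (fun q => _) = (fun q : M => atlas M1 j.1 q.1 0 b')); last first.
    by apply/funext => q; rewrite row_mxEl.
  rewrite (@partial_fst _ _ (fun q => atlas M1 j.1 q 0 b')).
  case: (fintype.split a) => a' /=.
    by rewrite splitl block_mxEul mxE.
  by rewrite splitr block_mxEdl mxE.
rewrite (_ : (fun q => _) = (fun q : M => atlas M2 j.2 q.2 0 b')); last first.
  by apply/funext => q; rewrite row_mxEr.
rewrite (@partial_snd _ _ (fun q => atlas M2 j.2 q 0 b')).
case: (fintype.split a) => a' /=.
  by rewrite splitl block_mxEur mxE.
by rewrite splitr block_mxEdr mxE.
Qed.

Let cod_prod (i : index M) : atlas M i @` dom (atlas M i) =
  (lsubmx @^-1` (atlas M1 i.1 @` dom (atlas M1 i.1))) `&`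
  (rsubmx @^-1` (atlas M2 i.2 @` dom (atlas M2 i.2))).
Proof. exact: prod_coord_image. Qed.

Lemma lyra_metric_pseudo_riemannian g1 g2 (f phi : M -> R) :
  pseudo_riemannian g1 -> pseudo_riemannian g2 ->
  smooth_fun f -> smooth_fun phi ->
  (forall p, 0 < f p) -> (forall p, 0 < phi p) ->
  pseudo_riemannian (lyra_metric g1 g2 f phi).
Proof.
move=> [s1 t1 y1 u1] [s2 t2 y2 u2] sf sphi f0 phi0; split.
- move=> i a b m.
  have oU := @cod_open _ _ _ (atlas M i).
  have sq h : smooth_fun h -> Ck_on m (atlas M i @` dom (atlas M i))
      (fun x => h (param (atlas M i) x) ^+ 2).
    by move=> sh; have := Ck_onM oU (sh i m) (sh i m).
  have C1 a1 b1 : Ck_on m (atlas M i @` dom (atlas M i))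
      (fun x => g1 i.1 (param (atlas M i) x).1 a1 b1).
    apply: Ck_on_sub (smooth_on_lsubmx (s1 i.1 a1 b1) m).
    by rewrite cod_prod => x [].
  have C2 a1 b1 : Ck_on m (atlas M i @` dom (atlas M i))
      (fun x => g2 i.2 (param (atlas M i) x).2 a1 b1).
    apply: Ck_on_sub (smooth_on_rsubmx (s2 i.2 a1 b1) m).
    by rewrite cod_prod => x [].
  pose G x : R := twisted_metric g1 g2 f i (param (atlas M i) x) a b.
  have CG : Ck_on m (atlas M i @` dom (atlas M i)) G.
    rewrite /G /twisted_metric -(splitK a) -(splitK b).
    case: (fintype.split a) (fintype.split b) => a' [] b' /=.
    + under eq_fun do rewrite block_mxEul; exact: C1.
    + under eq_fun do rewrite block_mxEur mxE; exact: Ck_on_cst.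
    + under eq_fun do rewrite block_mxEdl mxE; exact: Ck_on_cst.
    + under eq_fun do rewrite block_mxEdr mxE.
      exact: (Ck_onM oU (sq f sf) (C2 a' b')).
  under eq_fun do rewrite mxE.
  exact: (Ck_onM oU (sq phi sphi) CG).
- move=> i j p [/= d1 d2] [/= d1' d2'].
  rewrite /lyra_metric -scalemxAr -scalemxAl; congr (_ *: _).
  rewrite jacobian_prod /twisted_metric tr_block_mx !trmx0 !mulmx_block.
  rewrite !(mulmx0, mul0mx, addr0, add0r) -scalemxAr -scalemxAl.
  by rewrite -t1 // -t2.
- move=> i p [/= d1 d2]; rewrite /lyra_metric linearZ /=; congr (_ *: _).
  by rewrite /twisted_metric tr_block_mx !trmx0 y1 // linearZ /= y2.
- move=> i p [/= d1 d2].
  rewrite unitmxZ ?unitfE ?expf_neq0 ?gt_eqF // /twisted_metric.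
  rewrite unitmxE det_ublock unitrM -!unitmxE u1 //=.
  by rewrite unitmxZ ?unitfE ?expf_neq0 ?gt_eqF // u2.
Qed.

Lemma smooth_vector_field_lift (Z1 : vector_comp M1) (Z2 : vector_comp M2) :
  smooth_vector_field Z1 -> smooth_vector_field Z2 ->
  smooth_vector_field (fun i p => lift1 Z1 i p + lift2 Z2 i p).
Proof.
move=> [s1 t1] [s2 t2]; rewrite /lift1 /lift2; split.
- move=> i k m; rewrite -(splitK k).
  under eq_fun do rewrite add_row_mx addr0 add0r.
  case: (fintype.split k) => k' /=.
  + under eq_fun do rewrite row_mxEl.
    apply: Ck_on_sub (smooth_on_lsubmx (s1 i.1 k') m).
    by rewrite cod_prod => x [].
  + under eq_fun do rewrite row_mxEr.
    apply: Ck_on_sub (smooth_on_rsubmx (s2 i.2 k') m).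
    by rewrite cod_prod => x [].
- move=> i j p [/= d1 d2] [/= d1' d2'].
  rewrite !add_row_mx !(addr0, add0r) jacobian_prod mul_row_block.
  by rewrite !mulmx0 !(addr0, add0r) -t1 // -t2.
Qed.

End LyraTwistedProduct.

(* Main.v *)
Require Import Defs.
From mathcomp Require Import all_boot all_order all_algebra.
From mathcomp Require Import all_classical all_reals all_analysis.
From mathcomp Require Import ring.
Import Order.TTheory GRing.Theory Num.Theory.
Import numFieldNormedType.Exports.
Local Open Scope classical_set_scope.
Local Open Scope ring_scope.
Set Implicit Arguments.
Unset Strict Implicit.

(** The first identity is the trace of the soliton equation, since half the
    trace of [L_Z g] is [div Z].  For the second, Jacobi's formula turns the
    coordinate expression of the divergence into
    [div Z = d_a Z^a + 1/2 Z^c tr (g^-1 d_c g)], and [tr (g^-1 d_c g)] is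
    additive over the two blocks of [gL = phi^2 g1 (+) (phi f)^2 g2], a factor
    [h^2] in front of a block of size [m] adding [2 m d_c (ln h)] to it. *)

(** * Directional derivatives and the logarithm *)

Section DirectionalChainRule.
Context {R : realType} {V : normedModType R}.

(** The two difference quotients agree as functions of [t], so both the existence and the value of
    the limit pass to the one-variable restriction, where [is_derive1_comp] applies. *)
Let quotient_line (h : V -> R) (x v : V) :
  (fun t : R => t^-1 *: ((h \o shift x) (t *: v) - h x)) =
  (fun t : R => t^-1 *: (((fun s : R => h (s *: v + x)) \o shift 0) (t *: 1)
                         - h (0 *: v + x))).
Proof.
apply/funext => t /=; rewrite scale0r add0r addr0.
by rewrite [t *: 1]mulr1.
Qed.

Lemma derive_line (h : V -> R) (x v : V) :
  'D_v h x = 'D_1 (fun t : R => h (t *: v + x)) 0.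
Proof. by rewrite /derive quotient_line. Qed.

Lemma derivable_line (h : V -> R) (x v : V) :
  derivable h x v -> derivable (fun t : R => h (t *: v + x)) 0 1.
Proof. by rewrite /derivable quotient_line. Qed.

Lemma derive_ln_comp (h : V -> R) (x v : V) :
  0 < h x -> derivable h x v -> 'D_v (@ln R \o h) x = (h x)^-1 * 'D_v h x.
Proof.
move=> h0 dh; rewrite derive_line [in RHS]derive_line.
have H0 : 0 < (fun t : R => h (t *: v + x)) 0 by rewrite scale0r add0r.
have dln := is_derive1_ln H0.
have dH : is_derive (0 : R) 1 (fun t : R => h (t *: v + x))
    ('D_1 (fun t : R => h (t *: v + x)) 0).
  by split => //; exact: derivable_line.
have [_] := is_derive1_comp dln dH.
by rewrite scale0r add0r.
Qed.

End DirectionalChainRule.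

(** * Logarithmic derivatives of determinants in coordinates *)

Section LogDetPartial.
Context {R : realType} {n : nat} {M : manifold R n}.

(** Existence of the limit whose value is [partial i k h p]; [partial] itself is total, so the
    product and logarithm rules carry this as a hypothesis. *)
Definition derivable_at (i : Defs.index M) (k : 'I_n) (h : M -> R) (p : M) : Prop :=
  derivable (h \o param (atlas M i)) (atlas M i p) (delta_mx 0 k).

Lemma smooth_derivable_at i k (h : M -> R) p :
  smooth_on (atlas M i @` dom (atlas M i)) (h \o param (atlas M i)) ->
  dom (atlas M i) p -> derivable_at i k h p.
Proof. by move=> /(_ 1%N) [_ /(_ k) [dh _]] dp; apply: dh; exists p. Qed.

Lemma derivable_atM i k (h h' : M -> R) p :
  derivable_at i k h p -> derivable_at i k h' p ->
  derivable_at i k (fun q => h q * h' q) p.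
Proof. exact: derivableM. Qed.

Lemma partialM i k (h h' : M -> R) p : dom (atlas M i) p ->
  derivable_at i k h p -> derivable_at i k h' p ->
  partial i k (fun q => h q * h' q) p =
  h p * partial i k h' p + h' p * partial i k h p.
Proof.
by move=> dp dh dh'; have := deriveM dh dh'; rewrite /= coordK.
Qed.

Lemma partial_ln i k (h : M -> R) p : dom (atlas M i) p -> 0 < h p ->
  derivable_at i k h p ->
  partial i k (fun q => ln (h q)) p = (h p)^-1 * partial i k h p.
Proof.
move=> dp h0 dh; have := derive_ln_comp _ dh.
by rewrite /= coordK // => /(_ h0).
Qed.

Definition partial_mx {m} (i : Defs.index M) (k : 'I_n) (F : M -> 'M[R]_m) (p : M) :
  'M[R]_m := \matrix_(a, b) partial i k (fun q => F q a b) p.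

(* By Jacobi's formula this is [d_k ln |det F|]. *)
Definition logdet_partial {m} (i : Defs.index M) (k : 'I_n) (F : M -> 'M[R]_m)
  (p : M) : R := \tr (invmx (F p) *m partial_mx i k F p).

(** Multiplying [d_k (h^2 F) = h^2 d_k F + 2 h (d_k h) F] by [h^-2 F^-1] leaves [F^-1 d_k F] plus a
    multiple of the identity, whose trace supplies the factor [m]. *)
Lemma logdet_partial_sqrZ {m} i k (h : M -> R) (F : M -> 'M[R]_m) p :
  dom (atlas M i) p -> h p != 0 -> F p \in unitmx ->
  derivable_at i k h p ->
  (forall a b, derivable_at i k (fun q => F q a b) p) ->
  logdet_partial i k (fun q => h q ^+ 2 *: F q) p =
  2 * m%:R * ((h p)^-1 * partial i k h p) + logdet_partial i k F p.
Proof.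
move=> dp h0 uF dh dF; rewrite /logdet_partial invmxZ; last first.
  by rewrite unitmxZ // unitfE expf_neq0.
have -> : partial_mx i k (fun q => h q ^+ 2 *: F q) p =
    h p ^+ 2 *: partial_mx i k F p + (2 * h p * partial i k h p) *: F p.
  apply/matrixP => a b; rewrite !mxE.
  under [X in partial _ _ X]eq_fun do rewrite mxE expr2.
  rewrite partialM //; last exact: derivable_atM.
  by rewrite partialM //; ring.
rewrite -scalemxAl mulmxDr -!scalemxAr mulVmx // scalerDr !scalerA.
rewrite mulVf ?expf_neq0 // scale1r mxtraceD mxtraceZ mxtrace1 addrC.
by congr (_ + _); field.
Qed.

Lemma logdet_partial_block {m1 m2} i k (A : M -> 'M[R]_m1) (B : M -> 'M[R]_m2)
    p : A p \in unitmx -> B p \in unitmx ->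
  logdet_partial i k (fun q => block_mx (A q) 0 0 (B q)) p =
  logdet_partial i k A p + logdet_partial i k B p.
Proof.
move=> uA uB; rewrite /logdet_partial invmx_block_diag; last first.
  by rewrite unitmxE det_ublock unitrM -!unitmxE uA.
(* This settles the entries of the off-diagonal blocks, which vanish identically. *)
have p0 : partial i k (fun=> 0) p = 0 by exact: derive_cst.
have -> : partial_mx i k (fun q => block_mx (A q) 0 0 (B q)) p =
    block_mx (partial_mx i k A p) 0 0 (partial_mx i k B p).
  apply/matrixP => a b; rewrite mxE -(splitK a) -(splitK b).
  case: (fintype.split a) (fintype.split b) => a' [] b' /=.
  - by under eq_fun do rewrite block_mxEul; rewrite block_mxEul mxE.
  - by under eq_fun do rewrite block_mxEur mxE; rewrite block_mxEur mxE.
  - by under eq_fun do rewrite block_mxEdl mxE; rewrite block_mxEdl mxE.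
  - by under eq_fun do rewrite block_mxEdr; rewrite block_mxEdr mxE.
rewrite mulmx_block !(mulmx0, mul0mx, addr0, add0r).
exact: mxtrace_block.
Qed.

End LogDetPartial.

(** * Divergence in coordinates and the traced soliton equation *)

Section DivergenceTrace.
Context {R : realType} {n : nat} {M : manifold R n}.
Variables (g : tensor2_comp M) (Z : vector_comp M).
Hypothesis gP : pseudo_riemannian g.

Let inv_sym i p a b : dom (atlas M i) p ->
  invmx (g i p) a b = invmx (g i p) b a.
Proof.
case: gP => _ _ gT _ dp.
by rewrite -[in LHS](gT _ _ dp) -trmx_inv mxE.
Qed.

Let metric_sym i p a b : dom (atlas M i) p -> g i p a b = g i p b a.
Proof. by case: gP => _ _ gT _ dp; rewrite -[in LHS](gT _ _ dp) mxE. Qed.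

(** In the contracted Christoffel symbol [Gamma^a_(a c)] only the term with [d_c g] survives, which
    is half of [tr (g^-1 d_c g)]. *)
Lemma divergence_coord p : let i := chart_at M p in
  divergence g Z p = \sum_a partial i a (fun q => Z i q 0 a) p
    + 2^-1 * \sum_c Z i p 0 c * logdet_partial i c (g i) p.
Proof.
move=> i; have dp : dom (atlas M i) p := chart_atP p.
rewrite /divergence /mxtrace -/i.
under eq_bigr do rewrite mxE.
rewrite big_split /=; congr (_ + _).
rewrite exchange_big /= mulr_sumr; apply: eq_bigr => c _.
rewrite -mulr_suml mulrC mulrCA; congr (_ * _).
rewrite /levi_civita -mulr_sumr; congr (_ * _).
pose s a d := invmx (g i p) a d * partial i a (fun q => g i q d c) p.
pose t a d := invmx (g i p) a d * partial i d (fun q => g i q a c) p.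
transitivity (\sum_a \sum_d (s a d - t a d)
  + \sum_a \sum_d invmx (g i p) a d * partial i c (fun q => g i q d a) p).
  rewrite -big_split; apply: eq_bigr => a _ /=.
  by rewrite -big_split; apply: eq_bigr => d _ /=; rewrite /s /t; ring.
(* Exchanging [a] and [d] turns [t] into [s], because the inverse metric is symmetric; hence the
   difference sums to zero. *)
rewrite (_ : \sum_a \sum_d _ = 0).
  rewrite add0r /logdet_partial /mxtrace; apply: eq_bigr => a _.
  by rewrite mxE; apply: eq_bigr => d _; rewrite mxE.
under eq_bigr do rewrite big_split /= sumrN.
rewrite big_split /= sumrN [X in _ - X]exchange_big /=.
apply/eqP; rewrite subr_eq0; apply/eqP; apply: eq_bigr => a _.
by apply: eq_bigr => d _; rewrite /s /t inv_sym.
Qed.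

Lemma trace_metric i p : dom (atlas M i) p ->
  \sum_a \sum_b invmx (g i p) a b * g i p a b = n%:R.
Proof.
case: gP => _ _ _ gU dp; rewrite -(mxtrace1 R n) -(mulVmx (gU _ _ dp)).
apply: eq_bigr => a _; rewrite mxE; apply: eq_bigr => b _.
by rewrite metric_sym.
Qed.

(** Each of the two terms of [L_Z g] that differentiate [Z] contracts to the sum of the [d_a Z^a],
    and the term that differentiates [g] contracts to [Z^c tr (g^-1 d_c g)]; compare with twice
    [divergence_coord]. *)
Lemma trace_lie_derivative p : let i := chart_at M p in
  \sum_a \sum_b invmx (g i p) a b * lie_derivative Z g i p a b =
  2 * divergence g Z p.
Proof.
move=> i; have dp : dom (atlas M i) p := chart_atP p.
case: gP => _ _ _ gU.
rewrite divergence_coord -/i mulrDr mulrA mulfV ?pnatr_eq0 // mul1r.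
pose P a c := partial i a (fun q => Z i q 0 c) p.
have gVl a c : \sum_b invmx (g i p) a b * g i p c b = (a == c)%:R.
  have /matrixP/(_ a c) := mulVmx (gU _ _ dp); rewrite !mxE => <-.
  by apply: eq_bigr => b _; rewrite metric_sym.
have diag (F : 'I_n -> 'I_n -> R) :
    \sum_a \sum_c (a == c)%:R * F a c = \sum_a F a a.
  apply: eq_bigr => a _; rewrite (bigD1 a) //= eqxx mul1r big1 ?addr0 // => c.
  by rewrite eq_sym => /negPf ->; rewrite mul0r.
(* The third summand is the second one with [a] and [b] interchanged, so after an exchange of sums
   [half] evaluates both. *)
transitivity (\sum_a \sum_b \sum_c
    (Z i p 0 c * (invmx (g i p) a b * partial i c (fun q => g i q a b) p)
     + invmx (g i p) a b * g i p c b * P a c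
     + invmx (g i p) b a * g i p c a * P b c)).
  apply: eq_bigr => a _; apply: eq_bigr => b _; rewrite mxE mulr_sumr.
  apply: eq_bigr => c _; rewrite (@inv_sym i p b a) //.
  by rewrite (@metric_sym i p c a) // /P; ring.
under eq_bigr do under eq_bigr do rewrite !big_split /=.
under eq_bigr do rewrite !big_split /=.
rewrite !big_split /= [X in _ + _ + X]exchange_big /=.
have half : \sum_a \sum_b \sum_c invmx (g i p) a b * g i p c b * P a c =
    \sum_a P a a.
  rewrite -diag; apply: eq_bigr => a _; rewrite exchange_big /=.
  by apply: eq_bigr => c _; rewrite -gVl mulr_suml.
rewrite half -addrA addrC -mulr2n -[in LHS]mulr_natl; congr (_ + _).
(* Only the term with [d_c g] remains; the sum over [c] is moved outermost to match
   [logdet_partial]. *)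
under eq_bigr do rewrite exchange_big /=.
rewrite exchange_big /=; apply: eq_bigr => c _.
rewrite /logdet_partial /mxtrace mulr_sumr; apply: eq_bigr => a _.
rewrite mxE mulr_sumr; apply: eq_bigr => b _; rewrite mxE; congr (_ * (_ * _)).
by apply: partial_near => // q dq; rewrite metric_sym.
Qed.

Lemma soliton_trace (lam : M -> R) (rho : R) p :
  almost_ricci_bourguignon_soliton g Z lam rho ->
  (1 - n%:R * rho) * scalar_curvature g p + divergence g Z p = n%:R * lam p.
Proof.
(* The soliton equation is read in the chart [chart_at M p], where scalar curvature and divergence
   are both evaluated. *)
move=> [_ _ /(_ (chart_at M p) p (chart_atP p))]; set i := chart_at M p => sol.
have : \sum_a \sum_b invmx (g i p) a b *
      (ricci g i p + 2^-1 *: lie_derivative Z g i p) a b =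
    scalar_curvature g p + divergence g Z p.
  rewrite -[divergence g Z p]mul1r -[X in X * _](@mulVf R 2) ?pnatr_eq0 //.
  rewrite -mulrA -trace_lie_derivative -/i mulr_sumr /scalar_curvature -/i.
  rewrite -big_split /=.
  apply: eq_bigr => a _; rewrite mulr_sumr -big_split /=.
  apply: eq_bigr => b _.
  by rewrite !mxE; ring.
rewrite sol.
have -> (r : R) : \sum_a \sum_b invmx (g i p) a b * (r *: g i p) a b =
    r * n%:R.
  rewrite -(trace_metric (chart_atP p)) mulr_sumr; apply: eq_bigr => a _.
  by rewrite mulr_sumr; apply: eq_bigr => b _; rewrite mxE mulrCA.
move=> E; rewrite mulrBl mul1r addrAC -E; ring.
Qed.

End DivergenceTrace.

(** * Divergence of a sum of lifts for the Lyra metric *)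

Section ProductDivergence.
Context {R : realType} {n1 n2 : nat} {M1 : manifold R n1} {M2 : manifold R n2}.
Local Notation M := (prod_manifold M1 M2).

Lemma derivable_at_fst (i : Defs.index M) k (h : M1 -> R) (p : M) :
  (forall a, derivable_at i.1 a h p.1) ->
  derivable_at i k (fun q : M => h q.1) p.
Proof.
move=> dh; rewrite /derivable_at.
rewrite -[_ \o _]/((h \o param (atlas M1 i.1)) \o lsubmx).
apply: derivable_lsubmx; rewrite lsubmx_delta row_mxKl.
by case: fintype.split => [a|_]; [exact: dh|exact: derivable0].
Qed.

Lemma derivable_at_snd (i : Defs.index M) k (h : M2 -> R) (p : M) :
  (forall a, derivable_at i.2 a h p.2) ->
  derivable_at i k (fun q : M => h q.2) p.
Proof.
move=> dh; rewrite /derivable_at.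
rewrite -[_ \o _]/((h \o param (atlas M2 i.2)) \o rsubmx).
apply: derivable_rsubmx; rewrite rsubmx_delta row_mxKr.
by case: fintype.split => [_|a]; [exact: derivable0|exact: dh].
Qed.

Lemma logdet_partial_fst {m} (i : Defs.index M) k (F : M1 -> 'M[R]_m) (p : M) :
  logdet_partial i k (fun q : M => F q.1) p =
  if fintype.split k is inl a then logdet_partial i.1 a F p.1 else 0.
Proof.
rewrite /logdet_partial; have E a b := partial_fst i k (fun q => F q a b) p.
case: (fintype.split k) E => c E.
  by congr (\tr (_ *m _)); apply/matrixP => a b; rewrite !mxE E.
rewrite (_ : partial_mx i k _ p = 0) ?mulmx0 ?mxtrace0 //.
by apply/matrixP => a b; rewrite !mxE E.
Qed.

Lemma logdet_partial_snd {m} (i : Defs.index M) k (F : M2 -> 'M[R]_m) (p : M) :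
  logdet_partial i k (fun q : M => F q.2) p =
  if fintype.split k is inr a then logdet_partial i.2 a F p.2 else 0.
Proof.
rewrite /logdet_partial; have E a b := partial_snd i k (fun q => F q a b) p.
case: (fintype.split k) E => c E; last first.
  by congr (\tr (_ *m _)); apply/matrixP => a b; rewrite !mxE E.
rewrite (_ : partial_mx i k _ p = 0) ?mulmx0 ?mxtrace0 //.
by apply/matrixP => a b; rewrite !mxE E.
Qed.

Lemma logdet_partial_lyra (g1 : tensor2_comp M1) (g2 : tensor2_comp M2)
    (f phi : M -> R) (i : Defs.index M) k (p : M) :
  pseudo_riemannian g1 -> pseudo_riemannian g2 ->
  smooth_fun f -> smooth_fun phi ->
  (forall p, 0 < f p) -> (forall p, 0 < phi p) -> dom (atlas M i) p ->
  logdet_partial i k (lyra_metric g1 g2 f phi i) p =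
  logdet_partial i k (fun q : M => g1 i.1 q.1) p
  + logdet_partial i k (fun q : M => g2 i.2 q.2) p
  + 2 * (n2%:R * partial i k (fun q => ln (f q)) p
         + (n1 + n2)%:R * partial i k (fun q => ln (phi q)) p).
Proof.
move=> [s1 _ _ u1] [s2 _ _ u2] sf sphi f0 phi0 dp; have [dp1 dp2] := dp.
have df : derivable_at i k f p by exact: smooth_derivable_at.
have dphi : derivable_at i k phi p by exact: smooth_derivable_at.
have d1 a b : derivable_at i k (fun q : M => g1 i.1 q.1 a b) p.
  apply: (@derivable_at_fst i k (fun q => g1 i.1 q a b)) => c.
  by apply: smooth_derivable_at => //; exact: s1.
have d2 a b : derivable_at i k (fun q : M => g2 i.2 q.2 a b) p.
  apply: (@derivable_at_snd i k (fun q => g2 i.2 q a b)) => c.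
  by apply: smooth_derivable_at => //; exact: s2.
(* All conformal factors are moved into the blocks, so that each block is a square times a metric of
   one factor. *)
have -> : lyra_metric g1 g2 f phi i = fun q : M =>
    block_mx (phi q ^+ 2 *: g1 i.1 q.1) 0 0
             ((phi q * f q) ^+ 2 *: g2 i.2 q.2).
  apply/funext => q; rewrite /lyra_metric /twisted_metric scale_block_mx.
  by rewrite !scaler0 scalerA exprMn.
have nf : f p != 0 by rewrite gt_eqF.
have nphi : phi p != 0 by rewrite gt_eqF.
rewrite logdet_partial_block; first last.
- by rewrite unitmxZ ?u2 // unitfE expf_neq0 // mulf_neq0.
- by rewrite unitmxZ ?u1 // unitfE expf_neq0.
rewrite (@logdet_partial_sqrZ _ _ _ _ i k phi (fun q : M => g1 i.1 q.1)) ?u1 //.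
rewrite (@logdet_partial_sqrZ _ _ _ _ i k (fun q => phi q * f q)
  (fun q : M => g2 i.2 q.2)) ?u2 ?mulf_neq0 //; last exact: derivable_atM.
(* Dividing [d_k (phi f)] by [phi f] separates the two logarithms: [ln phi] is counted [n1] times
   from the first block and [n2] times from the second, [ln f] only [n2] times. *)
rewrite partialM // !partial_ln // natrD.
by field; rewrite nf nphi.
Qed.

Lemma sum_partial_lift (Z : vector_comp M) (Z1 : vector_comp M1)
    (Z2 : vector_comp M2) (i : Defs.index M) (p : M) :
  (forall i p, dom (atlas M i) p -> Z i p = lift1 Z1 i p + lift2 Z2 i p) ->
  dom (atlas M i) p ->
  \sum_a partial i a (fun q => Z i q 0 a) p =
  \sum_a partial i.1 a (fun q => Z1 i.1 q 0 a) p.1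
  + \sum_a partial i.2 a (fun q => Z2 i.2 q 0 a) p.2.
Proof.
move=> ZE dp; rewrite big_split_ord; congr (_ + _); apply: eq_bigr => a _.
- rewrite (@partial_near _ _ _ i _ _ (fun q : M => Z1 i.1 q.1 0 a)) //.
    rewrite (partial_fst i _ (fun q => Z1 i.1 q 0 a)).
    by rewrite (unsplitK (inl a)).
  by move=> q dq; rewrite ZE // mxE row_mxEl row_mxEl mxE addr0.
- rewrite (@partial_near _ _ _ i _ _ (fun q : M => Z2 i.2 q.2 0 a)) //.
    rewrite (partial_snd i _ (fun q => Z2 i.2 q 0 a)).
    by rewrite (unsplitK (inr a)).
  by move=> q dq; rewrite ZE // mxE row_mxEr row_mxEr mxE add0r.
Qed.

(** The coordinate formula is applied on the product and on both factors. Since [f] and [phi] may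
    vary along both factors, their logarithmic derivatives are taken along all of [Z]. *)
Lemma divergence_lyra (g1 : tensor2_comp M1) (g2 : tensor2_comp M2)
    (f phi : M -> R) (Z : vector_comp M) (Z1 : vector_comp M1)
    (Z2 : vector_comp M2) (p : M) :
  pseudo_riemannian g1 -> pseudo_riemannian g2 ->
  smooth_fun f -> smooth_fun phi ->
  (forall p, 0 < f p) -> (forall p, 0 < phi p) ->
  (forall i p, dom (atlas M i) p -> Z i p = lift1 Z1 i p + lift2 Z2 i p) ->
  divergence (lyra_metric g1 g2 f phi) Z p =
  divergence g1 Z1 p.1 + divergence g2 Z2 p.2
  + n2%:R * vector_apply Z (fun q => ln (f q)) p
  + (n1 + n2)%:R * vector_apply Z (fun q => ln (phi q)) p.
Proof.
move=> G1 G2 sf sphi f0 phi0 ZE.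
have dp := @chart_atP _ _ M p.
rewrite !divergence_coord //; last exact: lyra_metric_pseudo_riemannian.
rewrite (sum_partial_lift ZE dp) /vector_apply.
(* By construction [i] pairs the distinguished charts at [p.1] and [p.2], so the coordinate sums of
   the three divergences refer to the same charts. *)
set i := chart_at M p in dp *.
under [X in _ + 2^-1 * X = _]eq_bigr do
  rewrite logdet_partial_lyra // !mulrDr.
rewrite !big_split /=.
(* The entries of [g1] are constant along the coordinates of [M2]; along those of [M1] the
   components of [Z] are those of [Z1]. The sum for [g2] is symmetric to this. *)
have -> : \sum_c Z i p 0 c * logdet_partial i c (fun q : M => g1 i.1 q.1) p =
    \sum_c Z1 i.1 p.1 0 c * logdet_partial i.1 c (g1 i.1) p.1.
  rewrite big_split_ord /= [X in _ + X]big1 => [|c _].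
    rewrite addr0; apply: eq_bigr => c _.
    rewrite (logdet_partial_fst i _ (g1 i.1)) (unsplitK (inl c)).
    by rewrite ZE // mxE row_mxEl row_mxEl mxE addr0.
  by rewrite (logdet_partial_fst i _ (g1 i.1)) (unsplitK (inr c)) mulr0.
have -> : \sum_c Z i p 0 c * logdet_partial i c (fun q : M => g2 i.2 q.2) p =
    \sum_c Z2 i.2 p.2 0 c * logdet_partial i.2 c (g2 i.2) p.2.
  rewrite big_split_ord /= [X in X + _]big1 => [|c _].
    rewrite add0r; apply: eq_bigr => c _.
    rewrite (logdet_partial_snd i _ (g2 i.2)) (unsplitK (inr c)).
    by rewrite ZE // mxE row_mxEr row_mxEr mxE add0r.
  by rewrite (logdet_partial_snd i _ (g2 i.2)) (unsplitK (inl c)) mulr0.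
have pull (r : R) (h : M -> R) :
    \sum_c Z i p 0 c * (2 * (r * partial i c h p)) =
    2 * (r * \sum_c Z i p 0 c * partial i c h p).
  by rewrite !mulr_sumr; apply: eq_bigr => c _; ring.
rewrite !pull.
by field.
Qed.

End ProductDivergence.

(** * The trace identity and its form for sums of lifts *)

Unset Implicit Arguments.
Set Strict Implicit.

Theorem proposition3p2 (R : realType) (n1 n2 : nat)
    (M1 : manifold R n1) (M2 : manifold R n2)
    (g1 : tensor2_comp M1) (g2 : tensor2_comp M2)
    (f phi : prod_manifold M1 M2 -> R)
    (Z : vector_comp (prod_manifold M1 M2))
    (lam : prod_manifold M1 M2 -> R) (rho : R) :
  (0 < n1)%N -> (0 < n2)%N ->
  pseudo_riemannian g1 -> pseudo_riemannian g2 ->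
  smooth_fun f -> smooth_fun phi ->
  (forall p, 0 < f p) -> (forall p, 0 < phi p) ->
  let n : R := (n1 + n2)%:R in
  let k := fun p => ln (f p) in
  let sigma := fun p => ln (phi p) in
  let gL := lyra_metric g1 g2 f phi in
  almost_ricci_bourguignon_soliton gL Z lam rho ->
  (forall p, (1 - n * rho) * scalar_curvature gL p + divergence gL Z p
             = n * lam p) /\
  (forall (Z1 : vector_comp M1) (Z2 : vector_comp M2),
     smooth_vector_field Z1 -> smooth_vector_field Z2 ->
     (forall i p, dom (atlas (prod_manifold M1 M2) i) p ->
        Z i p = lift1 Z1 i p + lift2 Z2 i p) ->
     (forall p, divergence gL Z p =
        divergence g1 Z1 p.1 + divergence g2 Z2 p.2
        + n2%:R * vector_apply Z k p + n * vector_apply Z sigma p) /\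
     (forall p, (1 - n * rho) * scalar_curvature gL p
        + divergence g1 Z1 p.1 + divergence g2 Z2 p.2
        + n2%:R * vector_apply Z k p + n * vector_apply Z sigma p
        = n * lam p)).
Proof.
move=> _ _ G1 G2 sf sphi f0 phi0 n k sigma gL sol.
have trace p : (1 - n * rho) * scalar_curvature gL p + divergence gL Z p
    = n * lam p.
  by apply: soliton_trace => //; exact: lyra_metric_pseudo_riemannian.
split=> // Z1 Z2 _ _ ZE.
have divE p := divergence_lyra p G1 G2 sf sphi f0 phi0 ZE.
by split=> p; [exact: divE|rewrite -trace divE !addrA].
Qed.
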